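(* Let $X$ be a Polish space and $\mathcal K$ a separable Rosenthal compact on $X$ which is a pre-metric compactum of degree exactly two. Then for every dense sequence $\mathbf f=(f_n)_n$ in $\mathcal K$ the set $\mathcal L_{\mathbf f}$ is Borel.
   Context: A Rosenthal compact on a Polish space $X$ is a set of real-valued Baire-1 functions on $X$ compact in the pointwise topology; separable means having a countable dense subset; $\mathbf f$ is dense in $\mathcal K$ if $\{f_n\}$ is dense in $\mathcal K$. $\mathcal K$ is a pre-metric compactum of degree exactly two if there exist a countable set $D\subseteq X$ and a countable set $\mathcal D\subseteq\mathcal K$ such that at most two functions in $\mathcal K$ coincide on $D$, and for every $f\in\mathcal K\setminus\mathcal D$ there exists $g\in\mathcal K$ with $g\ne f$ and $g|_D=f|_D$. $[\mathbb N]$ is the set of infinite subsets of $\mathbb N$ (Polish subspace of $2^{\mathbb N}$), and $\mathcal L_{\mathbf f}=\{L\in[\mathbb N]:(f_n)_{n\in L}\text{ converges pointwise on }X\}$. *)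

(* Defs.v *)
From Stdlib Require Import Reals List.
Open Scope R_scope.

Definition countable {T : Type} (S : T -> Prop) : Prop :=
  exists e : T -> nat, forall a b, S a -> S b -> e a = e b -> a = b.

Definition is_metric {X : Type} (d : X -> X -> R) : Prop :=
  (forall x y, 0 <= d x y) /\
  (forall x y, d x y = 0 <-> x = y) /\
  (forall x y, d x y = d y x) /\
  (forall x y z, d x z <= d x y + d y z).

Definition metric_complete {X : Type} (d : X -> X -> R) : Prop :=
  forall u : nat -> X,
    (forall eps, eps > 0 -> exists N, forall m n, (m >= N)%nat -> (n >= N)%nat ->
        d (u m) (u n) < eps) ->
    exists l, forall eps, eps > 0 -> exists N, forall n, (n >= N)%nat -> d (u n) l < eps.

Definition metric_separable {X : Type} (d : X -> X -> R) : Prop :=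
  exists S : X -> Prop, countable S /\
    forall x eps, eps > 0 -> exists y, S y /\ d x y < eps.

Definition polish_metric {X : Type} (d : X -> X -> R) : Prop :=
  is_metric d /\ metric_complete d /\ metric_separable d.

Definition continuous_d {X : Type} (d : X -> X -> R) (g : X -> R) : Prop :=
  forall x eps, eps > 0 -> exists delta, delta > 0 /\
    forall y, d x y < delta -> Rabs (g y - g x) < eps.

Definition baire1 {X : Type} (d : X -> X -> R) (f : X -> R) : Prop :=
  exists g : nat -> X -> R, (forall k, continuous_d d (g k)) /\
    forall x, Un_cv (fun k => g k x) (f x).

Definition pw_open {X : Type} (U : (X -> R) -> Prop) : Prop :=
  forall f, U f -> exists (xs : list X) (eps : R), eps > 0 /\
    forall g, (forall x, In x xs -> Rabs (g x - f x) < eps) -> U g.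

Definition pw_compact {X : Type} (K : (X -> R) -> Prop) : Prop :=
  forall (I : Type) (U : I -> (X -> R) -> Prop),
    (forall i, pw_open (U i)) ->
    (forall f, K f -> exists i, U i f) ->
    exists l : list I, forall f, K f -> exists i, In i l /\ U i f.

Definition pw_dense_in {X : Type} (D K : (X -> R) -> Prop) : Prop :=
  (forall f, D f -> K f) /\
  forall f, K f -> forall (xs : list X) (eps : R), eps > 0 ->
    exists g, D g /\ forall x, In x xs -> Rabs (g x - f x) < eps.

Definition rosenthal_compact {X : Type} (d : X -> X -> R) (K : (X -> R) -> Prop) : Prop :=
  (forall f, K f -> baire1 d f) /\ pw_compact K.

Definition separable_pw {X : Type} (K : (X -> R) -> Prop) : Prop :=
  exists D, countable D /\ pw_dense_in D K.

Definition premetric_degree_two {X : Type} (K : (X -> R) -> Prop) : Prop :=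
  exists (D : X -> Prop) (DD : (X -> R) -> Prop),
    countable D /\ countable DD /\ (forall f, DD f -> K f) /\
    (forall f g h, K f -> K g -> K h ->
       (forall x, D x -> f x = g x) -> (forall x, D x -> g x = h x) ->
       f = g \/ g = h \/ f = h) /\
    (forall f, K f -> ~ DD f ->
       exists g, K g /\ g <> f /\ forall x, D x -> g x = f x).

Definition dense_seq {X : Type} (fs : nat -> X -> R) (K : (X -> R) -> Prop) : Prop :=
  pw_dense_in (fun g => exists n, g = fs n) K.

Definition cantor_open (U : (nat -> bool) -> Prop) : Prop :=
  forall A, U A -> exists n, forall B, (forall k, (k < n)%nat -> B k = A k) -> U B.

Inductive cantor_borel : ((nat -> bool) -> Prop) -> Prop :=
| borel_open : forall U, cantor_open U -> cantor_borel U
| borel_compl : forall B, cantor_borel B -> cantor_borel (fun A => ~ B A)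
| borel_union : forall Bs : nat -> (nat -> bool) -> Prop,
    (forall n, cantor_borel (Bs n)) -> cantor_borel (fun A => exists n, Bs n A).

Definition infinite_set (A : nat -> bool) : Prop :=
  forall N, exists n, (n >= N)%nat /\ A n = true.

Definition borel_in_infsets (L : (nat -> bool) -> Prop) : Prop :=
  (forall A, L A -> infinite_set A) /\
  exists B, cantor_borel B /\ forall A, infinite_set A -> (L A <-> B A).

Definition subseq_converges {X : Type} (fs : nat -> X -> R) (A : nat -> bool) : Prop :=
  forall x, exists l, forall eps, eps > 0 -> exists N, forall n,
    (n >= N)%nat -> A n = true -> Rabs (fs n x - l) < eps.

Definition L_set {X : Type} (fs : nat -> X -> R) : (nat -> bool) -> Prop :=
  fun A => infinite_set A /\ subseq_converges fs A.

(* Main.v *)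
Require Import Defs.
From Stdlib Require Import Reals List.
From Stdlib Require Import Lra Lia Cantor Classical ClassicalEpsilon.
From Stdlib Require Import FunctionalExtensionality PropExtensionality.

(* Suppose that the sequence converges along [L] to [f]. If some other function of [K] agrees
   with [f] on [D], then a sequence [s] of indices, whose functions converge to it on [D] and at
   a point [x] separating it from [f], witnesses the convergence along [L]: every accumulation
   point along [L] has the values of [f] on [D] but avoids the other function at [x], so there
   is only one of them. If not, then [f] is one of countably many functions, and convergence
   to [f] along [L] amounts to convergence on the countable set [D]. The first case is the
   projection of an F-sigma-delta condition on [(x, L, s)], because the functions are of the
   first Baire class, and so is divergence along [L]. Disjoint projections are separated by a
   Borel set, by Lusin's argument. *)

(** * Choice and elementary facts on limits *)

Lemma choice_fun {A B : Type} (R : A -> B -> Prop) :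
  (forall a, exists b, R a b) -> exists f : A -> B, forall a, R a (f a).
Proof.
  intros H.
  exists (fun a => proj1_sig (constructive_indefinite_description _ (H a))).
  intros a. exact (proj2_sig (constructive_indefinite_description _ (H a))).
Qed.

Lemma RinvN_small (eps : R) : eps > 0 -> exists m, / (INR m + 1) < eps.
Proof.
  intros H. destruct (archimed_cor1 eps H) as [N [HN Hpos]].
  exists (pred N). rewrite <- S_INR. replace (S (pred N)) with N by lia. exact HN.
Qed.

Lemma RinvN_anti (m n : nat) : (m <= n)%nat -> / (INR n + 1) <= / (INR m + 1).
Proof.
  intros H. apply Rinv_le_contravar; [pose proof (pos_INR m); lra|].
  apply le_INR in H. lra.
Qed.

(** With [Un_cv_dist_gt], this trades a gap between two Baire-1 values for an eventual gap between
    continuous approximants: a strict gap of the limits gives a weak one of the approximants, and a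
    weak one passes back. For fixed [k0] the weak gap is a closed condition. *)
Lemma Un_cv_dist_ge (u v : nat -> R) (a b eps : R) :
  Un_cv u a -> Un_cv v b ->
  (exists k0, forall k, (k >= k0)%nat -> eps <= Rabs (u k - v k)) -> eps <= Rabs (a - b).
Proof.
  intros Hu Hv [k0 Hk]. apply Rnot_lt_le. intros Hlt.
  set (e := (eps - Rabs (a - b)) / 2).
  assert (He : e > 0) by (unfold e; lra).
  destruct (Hu e He) as [N1 H1]. destruct (Hv e He) as [N2 H2].
  set (k := (k0 + N1 + N2)%nat).
  specialize (Hk k ltac:(lia)). specialize (H1 k ltac:(lia)). specialize (H2 k ltac:(lia)).
  unfold Rdist in *. unfold e in *.
  revert Hk H1 H2. revert Hlt. unfold Rabs. repeat destruct Rcase_abs; lra.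
Qed.

Lemma Un_cv_dist_gt (u v : nat -> R) (a b eps : R) :
  Un_cv u a -> Un_cv v b -> eps < Rabs (a - b) ->
  exists k0, forall k, (k >= k0)%nat -> eps <= Rabs (u k - v k).
Proof.
  intros Hu Hv Hlt.
  set (e := (Rabs (a - b) - eps) / 2).
  assert (He : e > 0) by (unfold e; lra).
  destruct (Hu e He) as [N1 H1]. destruct (Hv e He) as [N2 H2].
  exists (N1 + N2)%nat. intros k Hk.
  specialize (H1 k ltac:(lia)). specialize (H2 k ltac:(lia)).
  unfold Rdist in *. unfold e in *.
  revert H1 H2 Hlt. unfold Rabs. repeat destruct Rcase_abs; lra.
Qed.

(** * Borel separation in the Cantor space *)

Lemma borel_ext (A B : (nat -> bool) -> Prop) :
  (forall L, A L <-> B L) -> cantor_borel A -> cantor_borel B.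
Proof.
  intros H. replace B with A; auto.
  apply functional_extensionality. intros L. apply propositional_extensionality, H.
Qed.

Lemma borel_inter (Bs : nat -> (nat -> bool) -> Prop) :
  (forall n, cantor_borel (Bs n)) -> cantor_borel (fun L => forall n, Bs n L).
Proof.
  intros H. apply (borel_ext (fun L => ~ exists n, ~ Bs n L)).
  - intros L. split.
    + intros Hn n. apply NNPP. intros C. apply Hn. exists n. exact C.
    + intros Ha [n C]. exact (C (Ha n)).
  - apply borel_compl, (borel_union (fun n L => ~ Bs n L)). intros n.
    apply borel_compl, H.
Qed.

Lemma borel_coord (n : nat) (P : bool -> Prop) : cantor_borel (fun L => P (L n)).
Proof.
  apply borel_open. intros A HA. exists (S n). intros B HB. rewrite (HB n); [exact HA|lia].
Qed.

Definition borel_separated (A B : (nat -> bool) -> Prop) : Prop :=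
  exists C, cantor_borel C /\ (forall L, A L -> C L) /\ (forall L, B L -> ~ C L).

Lemma separated_mono (A A' B B' : (nat -> bool) -> Prop) :
  (forall L, A L -> A' L) -> (forall L, B L -> B' L) ->
  borel_separated A' B' -> borel_separated A B.
Proof. intros HA HB [C [HC [H1 H2]]]. exists C. firstorder. Qed.

Lemma separated_empty_l (A B : (nat -> bool) -> Prop) :
  (forall L, ~ A L) -> borel_separated A B.
Proof.
  intros H. exists (fun _ => False). split; [apply (borel_coord 0 (fun _ => False))|firstorder].
Qed.

Lemma separated_empty_r (A B : (nat -> bool) -> Prop) :
  (forall L, ~ B L) -> borel_separated A B.
Proof.
  intros H. exists (fun _ => True). split; [apply (borel_coord 0 (fun _ => True))|firstorder].
Qed.

(** If [C k l] separates [A k] from [B l], the union over [k] of the intersections over [l] of the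
    [C k l] separates the two unions. *)
Lemma separated_union (A B : nat -> (nat -> bool) -> Prop) :
  (forall k l, borel_separated (A k) (B l)) ->
  borel_separated (fun L => exists k, A k L) (fun L => exists l, B l L).
Proof.
  intros H.
  destruct (choice_fun (fun k F => forall l, cantor_borel (F l) /\
      (forall L, A k L -> F l L) /\ (forall L, B l L -> ~ F l L))) as [C HC].
  { intros k. apply (choice_fun (fun l F => cantor_borel F /\
      (forall L, A k L -> F L) /\ (forall L, B l L -> ~ F L))), H. }
  exists (fun L => exists k, forall l, C k l L). split; [|split].
  - apply (borel_union (fun k L => forall l, C k l L)). intros k. apply borel_inter.
    intros l. apply HC.
  - intros L [k Hk]. exists k. intros l. apply HC, Hk.
  - intros L [l Hl] [k Hk]. destruct (HC k l) as [_ [_ Hd]]. exact (Hd L Hl (Hk l)).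
Qed.

Lemma separated_or (A A' B : (nat -> bool) -> Prop) :
  borel_separated A B -> borel_separated A' B -> borel_separated (fun L => A L \/ A' L) B.
Proof.
  intros H1 H2.
  apply separated_mono with
    (A' := fun L => exists k, match k with O => A | S _ => A' end L)
    (B' := fun L => exists l : nat, B L).
  - intros L [H|H]; [exists 0%nat|exists 1%nat]; exact H.
  - intros L H. exists 0%nat. exact H.
  - apply (separated_union (fun k => match k with O => A | S _ => A' end) (fun _ => B)).
    intros [|k] _; assumption.
Qed.

Definition image {Z T : Type} (p : Z -> T) (P : Z -> Prop) : T -> Prop :=
  fun t => exists z, P z /\ p z = t.

(* [C i k] is the [k]-th piece of a covering of [P] of level [i]; [scheme_limit] says that a
   branch of nonempty pieces shrinks, after projection, to the projection of a point of [P]. *)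
Definition scheme_limit {Z : Type} (p : Z -> nat -> bool) (P : Z -> Prop)
    (C : nat -> nat -> Z -> Prop) : Prop :=
  forall a : nat -> nat, (forall n, exists z, forall i, (i < n)%nat -> C i (a i) z) ->
    exists z, P z /\ forall j z', (forall i, (i <= j)%nat -> C i (a i) z') -> p z' j = p z j.

(** Lusin's argument: by [separated_union], an inseparable pair contains an inseparable pair of
    pieces at the next level. The two branches so obtained lead to points of [P] and [Q] whose
    projections differ at some coordinate, and fixing that coordinate separates a late stage. *)
Lemma scheme_separation {Y Z : Type} (p : Y -> nat -> bool) (q : Z -> nat -> bool)
    (P : Y -> Prop) (Q : Z -> Prop)
    (C : nat -> nat -> Y -> Prop) (E : nat -> nat -> Z -> Prop) :
  (forall y i, P y -> exists k, C i k y) -> (forall z i, Q z -> exists k, E i k z) ->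
  scheme_limit p P C -> scheme_limit q Q E ->
  (forall y z, P y -> Q z -> p y <> q z) ->
  borel_separated (image p P) (image q Q).
Proof.
  intros HC HE LC LE Hdisj. apply NNPP. intros Hns.
  set (ns := fun st : (Y -> Prop) * (Z -> Prop) =>
    (forall y, fst st y -> P y) /\ (forall z, snd st z -> Q z) /\
    ~ borel_separated (image p (fst st)) (image q (snd st))).
  set (refine := fun (n : nat) (st : (Y -> Prop) * (Z -> Prop)) (kl : nat * nat) =>
    ((fun y => fst st y /\ C n (fst kl) y), (fun z => snd st z /\ E n (snd kl) z))).
  (* The implication stands under the existential quantifier so that the choice function below is
     total; [(0, 0)] is a dummy value. *)
  assert (step : forall n st, exists kl, ns st -> ns (refine n st kl)).
  { intros n st. destruct (classic (ns st)) as [Hst|Hst]; [|exists (0, 0)%nat; tauto].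
    apply NNPP. intros Hno. destruct Hst as [H1 [H2 H3]]. apply H3.
    apply separated_mono with
      (A' := fun L => exists k, image p (fun y => fst st y /\ C n k y) L)
      (B' := fun L => exists l, image q (fun z => snd st z /\ E n l z) L).
    - intros L [y [Hy Hp]]. destruct (HC y n (H1 y Hy)) as [k Hk]. exists k, y. auto.
    - intros L [z [Hz Hq]]. destruct (HE z n (H2 z Hz)) as [k Hk]. exists k, z. auto.
    - apply separated_union. intros k l. apply NNPP. intros Hkl. apply Hno.
      exists (k, l). intros _. unfold ns, refine; simpl. split; [|split].
      + intros y [Hy _]. auto.
      + intros z [Hz _]. auto.
      + exact Hkl. }
  destruct (choice_fun (fun (nst : nat * ((Y -> Prop) * (Z -> Prop))) kl =>
     ns (snd nst) -> ns (refine (fst nst) (snd nst) kl))) as [pick Hpick].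
  { intros [n st]. apply step. }
  set (st := fix st n := match n with
    | O => (P, Q)
    | S m => refine m (st m) (pick (m, st m))
    end).
  assert (Hst : forall n, ns (st n)).
  { induction n as [|n IH]; [unfold ns; simpl; auto|]. apply (Hpick (n, st n)), IH. }
  set (a := fun n => fst (pick (n, st n))). set (b := fun n => snd (pick (n, st n))).
  assert (Ha : forall n y, fst (st n) y -> forall i, (i < n)%nat -> C i (a i) y).
  { induction n as [|n IH]; intros y Hy i Hi; [lia|].
    destruct Hy as [Hy1 Hy2].
    destruct (Nat.eq_dec i n) as [->|Hne]; [exact Hy2|apply (IH y Hy1); lia]. }
  assert (Hb : forall n z, snd (st n) z -> forall i, (i < n)%nat -> E i (b i) z).
  { induction n as [|n IH]; intros y Hy i Hi; [lia|].
    destruct Hy as [Hy1 Hy2].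
    destruct (Nat.eq_dec i n) as [->|Hne]; [exact Hy2|apply (IH y Hy1); lia]. }
  (* No stage has an empty side, since an empty set is separated from anything. *)
  destruct (LC a) as [y [Hy Hya]].
  { intros n. apply NNPP. intros Hno. destruct (Hst n) as [_ [_ H]]. apply H.
    apply separated_empty_l. intros L [y [Hy _]]. apply Hno. exists y. apply Ha, Hy. }
  destruct (LE b) as [z [Hz Hzb]].
  { intros n. apply NNPP. intros Hno. destruct (Hst n) as [_ [_ H]]. apply H.
    apply separated_empty_r. intros L [z [Hz _]]. apply Hno. exists z. apply Hb, Hz. }
  apply (Hdisj y z Hy Hz). apply functional_extensionality. intros j.
  (* Stage [S j] has passed the levels [0] to [j], which fix coordinate [j] of the projections on
     both sides. *)
  apply NNPP. intros Hj. destruct (Hst (S j)) as [_ [_ H]]. apply H.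
  exists (fun L => L j = p y j). split; [apply (borel_coord j (fun v => v = p y j))|split].
  - intros L [y' [Hy' <-]]. apply Hya. intros i Hi. apply (Ha _ _ Hy'). lia.
  - intros L [z' [Hz' <-]] Heq. apply Hj. rewrite <- Heq. apply Hzb.
    intros i Hi. apply (Hb _ _ Hz'). lia.
Qed.

(** * Projections of F-sigma-delta sets *)

(** A point of the Polish product of [X], the Cantor space and the Baire space. The index set is
    what remains after projection; the other two components carry the witnesses. *)
Record point (X : Type) : Type := Point {
  pt_x : X;
  pt_set : nat -> bool;
  pt_seq : nat -> nat
}.
Arguments Point {X}.
Arguments pt_x {X}.
Arguments pt_set {X}.
Arguments pt_seq {X}.

Definition pt_close {X : Type} (d : X -> X -> R) (m : nat) (z z' : point X) : Prop :=
  d (pt_x z) (pt_x z') < / (INR m + 1) /\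
  forall j, (j <= m)%nat -> pt_set z' j = pt_set z j /\ pt_seq z' j = pt_seq z j.

Definition pt_closed {X : Type} (d : X -> X -> R) (C : point X -> Prop) : Prop :=
  forall z, (forall m, exists z', pt_close d m z z' /\ C z') -> C z.

Definition Fsigma {X : Type} (d : X -> X -> R) (P : point X -> Prop) : Prop :=
  exists C : nat -> point X -> Prop, (forall k, pt_closed d (C k)) /\
    forall z, P z <-> exists k, C k z.

Definition Fsigmadelta {X : Type} (d : X -> X -> R) (P : point X -> Prop) : Prop :=
  exists C : nat -> nat -> point X -> Prop, (forall i k, pt_closed d (C i k)) /\
    forall z, P z <-> forall i, exists k, C i k z.

Lemma closed_forall {X I : Type} (d : X -> X -> R) (C : I -> point X -> Prop) :
  (forall i, pt_closed d (C i)) -> pt_closed d (fun z => forall i, C i z).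
Proof.
  intros H z Hz i. apply (H i). intros m. destruct (Hz m) as [z' [H1 H2]].
  exists z'. auto.
Qed.

Lemma closed_and {X : Type} (d : X -> X -> R) (C E : point X -> Prop) :
  pt_closed d C -> pt_closed d E -> pt_closed d (fun z => C z /\ E z).
Proof. intros H1 H2 z Hz. split; [apply H1|apply H2]; firstorder. Qed.

Lemma pt_close_le {X : Type} (d : X -> X -> R) (m n : nat) (z z' : point X) :
  (m <= n)%nat -> pt_close d n z z' -> pt_close d m z z'.
Proof.
  intros H [H1 H2]. split; [pose proof (RinvN_anti m n H); lra|].
  intros j Hj. apply H2. lia.
Qed.

(** The premise depends on coordinate [n] only, so it is clopen: approximations of precision [m + n]
    share it with [z] and are still [m]-close. *)
Lemma closed_coord_imp {X : Type} (d : X -> X -> R) (n : nat) (P : bool -> nat -> Prop)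
    (C : point X -> Prop) :
  pt_closed d C -> pt_closed d (fun z => P (pt_set z n) (pt_seq z n) -> C z).
Proof.
  intros H z Hz HP. apply H. intros m. destruct (Hz (m + n)%nat) as [z' [H1 H2]].
  exists z'. split; [apply (pt_close_le d m (m + n)); [lia|exact H1]|].
  apply H2. destruct H1 as [_ H1]. destruct (H1 n ltac:(lia)) as [-> ->]. exact HP.
Qed.

Lemma closed_coord {X : Type} (d : X -> X -> R) (n : nat) (P : bool -> nat -> Prop) :
  pt_closed d (fun z => P (pt_set z n) (pt_seq z n)).
Proof.
  intros z Hz. destruct (Hz n) as [z' [[_ H1] H2]].
  destruct (H1 n ltac:(lia)) as [<- <-]. exact H2.
Qed.

Lemma closed_dist_ge {X : Type} (d : X -> X -> R) (g h : X -> R) (eps : R) :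
  continuous_d d g -> continuous_d d h ->
  pt_closed d (fun z => eps <= Rabs (g (pt_x z) - h (pt_x z))).
Proof.
  intros Hg Hh z Hz. apply Rnot_lt_le. intros Hlt.
  set (e := (eps - Rabs (g (pt_x z) - h (pt_x z))) / 2).
  assert (He : e > 0) by (unfold e; lra).
  destruct (Hg (pt_x z) e He) as [d1 [Hd1 H1]]. destruct (Hh (pt_x z) e He) as [d2 [Hd2 H2]].
  destruct (RinvN_small (Rmin d1 d2)) as [m Hm]; [apply Rmin_pos; lra|].
  destruct (Hz m) as [z' [[Hc _] Hge]].
  pose proof (Rmin_l d1 d2). pose proof (Rmin_r d1 d2).
  specialize (H1 (pt_x z') ltac:(lra)). specialize (H2 (pt_x z') ltac:(lra)).
  unfold e in *. revert Hge H1 H2 Hlt. unfold Rabs. repeat destruct Rcase_abs; lra.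
Qed.

Lemma Fsigma_closed {X : Type} (d : X -> X -> R) (C : point X -> Prop) :
  pt_closed d C -> Fsigma d C.
Proof.
  intros H. exists (fun _ => C). split; [auto|]. intros z. split; [exists 0%nat; auto|].
  intros [_ Hz]. exact Hz.
Qed.

Lemma Fsigma_exists {X : Type} (d : X -> X -> R) (P : nat -> point X -> Prop) :
  (forall n, Fsigma d (P n)) -> Fsigma d (fun z => exists n, P n z).
Proof.
  intros H. destruct (choice_fun _ H) as [C HC].
  exists (fun k => C (fst (of_nat k)) (snd (of_nat k))). split; [intros k; apply HC|].
  intros z. split.
  - intros [n Hn]. apply HC in Hn. destruct Hn as [k Hk]. exists (to_nat (n, k)).
    rewrite cancel_of_to. exact Hk.
  - intros [k Hk]. exists (fst (of_nat k)). apply HC. exists (snd (of_nat k)). exact Hk.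
Qed.

Lemma Fsigmadelta_Fsigma {X : Type} (d : X -> X -> R) (P : point X -> Prop) :
  Fsigma d P -> Fsigmadelta d P.
Proof.
  intros [C [HC HP]]. exists (fun _ => C). split; [auto|]. intros z. rewrite HP.
  split; [auto|]. intros H. exact (H 0%nat).
Qed.

Lemma Fsigmadelta_forall {X : Type} (d : X -> X -> R) (P : nat -> point X -> Prop) :
  (forall n, Fsigmadelta d (P n)) -> Fsigmadelta d (fun z => forall n, P n z).
Proof.
  intros H. destruct (choice_fun _ H) as [C HC].
  exists (fun i => C (fst (of_nat i)) (snd (of_nat i))). split; [intros i; apply HC|].
  intros z. split.
  - intros Hn i. apply (HC (fst (of_nat i))), Hn.
  - intros Hi n. apply HC. intros i. specialize (Hi (to_nat (n, i))).
    rewrite cancel_of_to in Hi. exact Hi.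
Qed.


Lemma Fsigmadelta_and {X : Type} (d : X -> X -> R) (P Q : point X -> Prop) :
  Fsigmadelta d P -> Fsigmadelta d Q -> Fsigmadelta d (fun z => P z /\ Q z).
Proof.
  intros HP HQ.
  destruct (Fsigmadelta_forall d (fun n => match n with O => P | S _ => Q end))
    as [C [HC HPQ]].
  { intros [|n]; auto. }
  exists C. split; [exact HC|]. intros z. rewrite <- HPQ. split.
  - intros [H1 H2] [|n]; auto.
  - intros H. split; [exact (H 0%nat)|exact (H 1%nat)].
Qed.

(** The index [k] of a piece codes a point of the countable dense set near [pt_x z] together with
    the [i]-th entries of the set and the sequence. Two points of a piece are near the same dense
    point, whence the factor 2. *)
Lemma polish_pieces {X : Type} (d : X -> X -> R) : polish_metric d ->
  exists B : nat -> nat -> point X -> Prop,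
    (forall i z, exists k, B i k z) /\
    forall i k z z', B i k z -> B i k z' ->
      pt_set z' i = pt_set z i /\ pt_seq z' i = pt_seq z i /\
      d (pt_x z) (pt_x z') < 2 * / (INR i + 1).
Proof.
  intros [[_ [_ [Hsym Htri]]] [_ [S [[e He] HS]]]].
  exists (fun i k z => exists y, S y /\ d (pt_x z) y < / (INR i + 1) /\
    k = to_nat (e y, to_nat (Nat.b2n (pt_set z i), pt_seq z i))).
  split.
  - intros i z. destruct (HS (pt_x z) (/ (INR i + 1))) as [y [Hy1 Hy2]]; [apply RinvN_pos|].
    eexists. exists y. eauto.
  - intros i k z z' [y [Hy [Hd Hk]]] [y' [Hy' [Hd' Hk']]].
    rewrite Hk in Hk'. apply (f_equal of_nat) in Hk'. rewrite !cancel_of_to in Hk'.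
    apply pair_equal_spec in Hk'. destruct Hk' as [H1 H2].
    apply (f_equal of_nat) in H2. rewrite !cancel_of_to in H2.
    apply pair_equal_spec in H2. destruct H2 as [H2 H3]. apply He in H1; auto. subst y'.
    split; [|split; [auto|]].
    + destruct (pt_set z i), (pt_set z' i); simpl in H2; congruence.
    + pose proof (Htri (pt_x z) y (pt_x z')). rewrite (Hsym y) in H. lra.
Qed.

(** A piece is a closed set of the F-sigma-delta representation cut down to a small piece of the
    space. Points chosen along a branch form a Cauchy sequence, and the closed sets keep its
    limit. *)
Lemma Fsigmadelta_scheme {X : Type} (d : X -> X -> R) (P : point X -> Prop) :
  polish_metric d -> Fsigmadelta d P ->
  exists C : nat -> nat -> point X -> Prop,
    (forall z i, P z -> exists k, C i k z) /\ scheme_limit pt_set P C.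
Proof.
  intros HX [F [HF HP]]. destruct (polish_pieces d HX) as [B [HB1 HB2]].
  exists (fun i k z => F i (fst (of_nat k)) z /\ B i (snd (of_nat k)) z). split.
  { intros z i Hz. rewrite HP in Hz. destruct (Hz i) as [k Hk].
    destruct (HB1 i z) as [l Hl]. exists (to_nat (k, l)). rewrite cancel_of_to. auto. }
  intros a Ha. destruct (choice_fun _ Ha) as [zs Hzs].
  assert (Hzz : forall i m n, (i < m)%nat -> (i < n)%nat ->
    pt_set (zs n) i = pt_set (zs m) i /\ pt_seq (zs n) i = pt_seq (zs m) i /\
    d (pt_x (zs m)) (pt_x (zs n)) < 2 * / (INR i + 1)).
  { intros i m n Hm Hn. apply (HB2 i (snd (of_nat (a i)))); apply Hzs; auto. }
  destruct HX as [[_ [_ [Hsym _]]] [Hcomp _]].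
  destruct (Hcomp (fun n => pt_x (zs n))) as [x Hx].
  { intros eps Heps. destruct (RinvN_small (eps / 2)) as [i Hi]; [lra|].
    exists (S i). intros m n Hm Hn. destruct (Hzz i m n) as [_ [_ H]]; lia || lra. }
  (* Coordinate [j] is constant along [zs n] for [n > j], all of these lying in one piece of level
     [j], so [zs (S j)] already shows its limit value. *)
  set (z := Point x (fun j => pt_set (zs (S j)) j) (fun j => pt_seq (zs (S j)) j)).
  exists z. split.
  - apply HP. intros i. exists (fst (of_nat (a i))). apply HF. intros m.
    destruct (Hx (/ (INR m + 1))) as [N HN]; [apply RinvN_pos|].
    (* Beyond [N] for the distance, beyond [m] for the coordinates, and beyond [i] for membership in
       the closed set of level [i]. *)
    exists (zs (S (N + m + i))). split.
    + split.
      * rewrite Hsym. apply HN. lia.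
      * intros j Hj. simpl. destruct (Hzz j (S j) (S (N + m + i))) as [H1 [H2 _]]; auto; lia.
    + apply Hzs. lia.
  - intros j z' Hz'. simpl. apply (HB2 j (snd (of_nat (a j)))); [apply Hzs|apply Hz']; lia.
Qed.

Lemma Fsigmadelta_separation {X : Type} (d : X -> X -> R) (P Q : point X -> Prop) :
  polish_metric d -> Fsigmadelta d P -> Fsigmadelta d Q ->
  (forall z w, P z -> Q w -> pt_set z <> pt_set w) ->
  borel_separated (image pt_set P) (image pt_set Q).
Proof.
  intros HX HP HQ Hdisj.
  destruct (Fsigmadelta_scheme d P HX HP) as [C [HC LC]].
  destruct (Fsigmadelta_scheme d Q HX HQ) as [E [HE LE]].
  exact (scheme_separation pt_set pt_set P Q C E HC HE LC LE Hdisj).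
Qed.

(** * Convergence along a set of indices *)

Definition cluster_along {X : Type} (fs : nat -> X -> R) (L : nat -> bool) (f : X -> R) : Prop :=
  forall (xs : list X) (eps : R), eps > 0 -> forall N, exists n, (n >= N)%nat /\
    L n = true /\ forall x, In x xs -> Rabs (fs n x - f x) < eps.

Lemma compact_cluster {X : Type} (K : (X -> R) -> Prop) (u : nat -> X -> R) :
  pw_compact K -> (forall n, K (u n)) ->
  exists f, K f /\ forall (xs : list X) (eps : R), eps > 0 -> forall N, exists n,
    (n >= N)%nat /\ forall x, In x xs -> Rabs (u n x - f x) < eps.
Proof.
  intros HK Hu. apply NNPP. intros Hno.
  (* [U N] is the union of the open sets missed by the tail from [N] on. Without an accumulation
     point these cover [K], and a finite subcover is a list of thresholds; the term of [u] at their
     maximum lies in none of its members. *)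
  set (U := fun (N : nat) (g : X -> R) =>
    exists V, pw_open V /\ V g /\ forall n, (n >= N)%nat -> ~ V (u n)).
  destruct (HK nat U) as [l Hl].
  - intros N f [V [HV [Hf HN]]]. destruct (HV f Hf) as [xs [eps [He Hg]]].
    exists xs, eps. split; [exact He|]. intros g Hgx. exists V. auto.
  - intros f Hf. apply NNPP. intros Hnf. apply Hno. exists f. split; [exact Hf|].
    intros xs eps He N. apply NNPP. intros Hn. apply Hnf. exists N.
    exists (fun g => forall x, In x xs -> Rabs (g x - f x) < eps). split; [|split].
    + intros g Hg.
      assert (exists e, e > 0 /\ forall x, In x xs -> Rabs (g x - f x) + e <= eps)
        as [e [He' Hge]].
      { clear Hn. induction xs as [|y xs IH].
        - exists eps. split; [exact He|]. intros x [].
        - destruct IH as [e [H1 H2]]; [intros x Hx; apply Hg; right; exact Hx|].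
          pose proof (Hg y (or_introl eq_refl)).
          exists (Rmin e (eps - Rabs (g y - f y))). split; [apply Rmin_pos; lra|].
          pose proof (Rmin_l e (eps - Rabs (g y - f y))).
          pose proof (Rmin_r e (eps - Rabs (g y - f y))).
          intros x [<-|Hx]; [lra|]. specialize (H2 x Hx). lra. }
      exists xs, e. split; [exact He'|]. intros h Hh x Hx.
      specialize (Hh x Hx). specialize (Hge x Hx).
      replace (h x - f x) with ((h x - g x) + (g x - f x)) by ring.
      pose proof (Rabs_triang (h x - g x) (g x - f x)). lra.
    + intros x _. rewrite Rminus_diag, Rabs_R0. exact He.
    + intros n Hn1 Hn2. apply Hn. exists n. auto.
  - destruct (Hl (u (list_max l)) (Hu _)) as [N [HN [V [_ [HV H]]]]].
    apply (H (list_max l)); [|exact HV].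
    pose proof (proj1 (list_max_le l (list_max l)) (le_n _)) as Hall.
    rewrite Forall_forall in Hall. apply Hall, HN.
Qed.

Lemma cluster_along_exists {X : Type} (K : (X -> R) -> Prop) (fs : nat -> X -> R) (L : nat -> bool) :
  pw_compact K -> (forall n, K (fs n)) -> infinite_set L -> exists f, K f /\ cluster_along fs L f.
Proof.
  intros HK Hfs HL. destruct (choice_fun _ HL) as [p Hp].
  destruct (compact_cluster K (fun n => fs (p n)) HK) as [f [Hf Hc]]; [auto|].
  exists f. split; [exact Hf|]. intros xs eps He N.
  destruct (Hc xs eps He N) as [n [Hn Hx]]. exists (p n).
  destruct (Hp n). repeat split; auto. lia.
Qed.

(** If convergence failed at [x], the indices of [L] whose functions stay [eps] away from [f x]
    would form an infinite set with an accumulation point of its own, which is one along [L] and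
    differs from [f] at [x]. *)
Lemma unique_cluster_converges {X : Type} (K : (X -> R) -> Prop) (fs : nat -> X -> R)
    (L : nat -> bool) :
  pw_compact K -> (forall n, K (fs n)) -> infinite_set L ->
  (forall f g, K f -> K g -> cluster_along fs L f -> cluster_along fs L g -> f = g) ->
  subseq_converges fs L.
Proof.
  intros HK Hfs HL Huniq. destruct (cluster_along_exists K fs L HK Hfs HL) as [f [Hf Hc]].
  intros x. exists (f x). intros eps He. apply NNPP. intros Hno.
  set (M := fun n => if Rlt_dec (Rabs (fs n x - f x)) eps then false else L n).
  assert (HM : infinite_set M).
  { intros N. apply NNPP. intros HN. apply Hno. exists N. intros n Hn HLn.
    apply Rnot_ge_lt. intros Hge. apply HN. exists n. split; [exact Hn|].
    unfold M. destruct Rlt_dec; [lra|exact HLn]. }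
  destruct (cluster_along_exists K fs M HK Hfs HM) as [g [Hg Hcg]].
  assert (Hcg' : cluster_along fs L g).
  { intros xs e He' N. destruct (Hcg xs e He' N) as [n [Hn [HMn Hx]]].
    exists n. repeat split; auto. unfold M in HMn. destruct Rlt_dec; congruence. }
  destruct (Hcg (x :: nil) eps He 0%nat) as [n [_ [HMn Hx]]].
  specialize (Hx x (or_introl eq_refl)). rewrite <- (Huniq f g Hf Hg Hc Hcg') in Hx.
  unfold M in HMn. destruct Rlt_dec; [discriminate|lra].
Qed.

Lemma cluster_is_limit {X : Type} (fs : nat -> X -> R) (L : nat -> bool) (f : X -> R) :
  subseq_converges fs L -> cluster_along fs L f ->
  forall x eps, eps > 0 -> exists N, forall n, (n >= N)%nat -> L n = true ->
    Rabs (fs n x - f x) < eps.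
Proof.
  intros Hcv Hc x eps He. destruct (Hcv x) as [l Hl].
  destruct (Hl (eps / 3)) as [N HN]; [lra|].
  exists N. intros n Hn HLn.
  destruct (Hc (x :: nil) (eps / 3) ltac:(lra) N) as [m [Hm [HLm Hx]]].
  specialize (Hx x (or_introl eq_refl)).
  pose proof (HN n Hn HLn) as H1. pose proof (HN m Hm HLm) as H2.
  revert H1 H2 Hx. unfold Rabs. repeat destruct Rcase_abs; lra.
Qed.

(** Failure of the Cauchy criterion at one point. Gaps of the form [/ (INR j + 1)] leave countably
    many cases, and strictness is what [Un_cv_dist_gt] asks for. *)
Lemma not_converges_oscillates {X : Type} (fs : nat -> X -> R) (L : nat -> bool) :
  infinite_set L -> ~ subseq_converges fs L ->
  exists x j, forall N, exists n m, (n >= N)%nat /\ (m >= N)%nat /\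
    L n = true /\ L m = true /\ / (INR j + 1) < Rabs (fs n x - fs m x).
Proof.
  intros HL Hno. destruct (choice_fun _ HL) as [p Hp].
  apply NNPP. intros Hosc. apply Hno. intros x.
  assert (HC : forall eps, eps > 0 -> exists N, forall n m, (n >= N)%nat -> (m >= N)%nat ->
     L n = true -> L m = true -> Rabs (fs n x - fs m x) < eps).
  { intros eps He. destruct (RinvN_small eps He) as [j Hj].
    apply NNPP. intros HN. apply Hosc. exists x, j. intros N.
    apply NNPP. intros H. apply HN. exists N. intros n m Hn Hm HLn HLm.
    apply Rnot_ge_lt. intros Hge. apply H. exists n, m. repeat split; auto. lra. }
  destruct (R_complete (fun n => fs (p n) x)) as [l Hl].
  { intros eps He. destruct (HC eps He) as [N HN]. exists N. intros n m Hn Hm.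
    apply HN; try apply Hp; destruct (Hp n), (Hp m); lia. }
  exists l. intros eps He. destruct (HC (eps / 2)) as [N HN]; [lra|].
  destruct (Hl (eps / 2)) as [N' HN']; [lra|].
  exists N. intros n Hn HLn.
  destruct (Hp (N + N')%nat) as [H1 H2].
  pose proof (HN n (p (N + N')%nat) Hn ltac:(lia) HLn H2).
  specialize (HN' (N + N')%nat ltac:(lia)). unfold Rdist in HN'.
  replace (fs n x - l) with ((fs n x - fs (p (N + N')%nat) x) + (fs (p (N + N')%nat) x - l))
    by ring.
  pose proof (Rabs_triang (fs n x - fs (p (N + N')%nat) x) (fs (p (N + N')%nat) x - l)).
  lra.
Qed.

Lemma oscillates_not_converges {X : Type} (fs : nat -> X -> R) (L : nat -> bool)
    (x : X) (eps : R) : eps > 0 ->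
  (forall N, exists n m, (n >= N)%nat /\ (m >= N)%nat /\
    L n = true /\ L m = true /\ eps <= Rabs (fs n x - fs m x)) ->
  ~ subseq_converges fs L.
Proof.
  intros He Hosc Hcv. destruct (Hcv x) as [l Hl].
  destruct (Hl (eps / 2)) as [N HN]; [lra|].
  destruct (Hosc N) as [n [m [Hn [Hm [HLn [HLm Hge]]]]]].
  pose proof (HN n Hn HLn) as H1. pose proof (HN m Hm HLm) as H2.
  revert Hge H1 H2. unfold Rabs. repeat destruct Rcase_abs; lra.
Qed.

(** * Oscillation and twin witnesses *)

Definition agree {X : Type} (D : X -> Prop) (f g : X -> R) : Prop :=
  forall x, D x -> f x = g x.

Lemma closed_eventually_ge {X : Type} (d : X -> X -> R) (g h : nat -> X -> R) (k0 : nat)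
    (eps : R) :
  (forall k, continuous_d d (g k)) -> (forall k, continuous_d d (h k)) ->
  pt_closed d (fun z => forall k, (k >= k0)%nat ->
    eps <= Rabs (g k (pt_x z) - h k (pt_x z))).
Proof.
  intros Hg Hh. apply closed_forall. intros k. apply closed_forall. intros _.
  apply closed_dist_ge; auto.
Qed.

(** Divergence at [pt_x z], expressed by the continuous approximants [g n k] of the [n]-th function:
    a bound from some [k0] on gives a countable union of closed sets for each [N]. *)
Definition oscillation {X : Type} (g : nat -> nat -> X -> R) (j : nat) (z : point X) : Prop :=
  forall N, exists n m k0, ((n >= N)%nat /\ (m >= N)%nat) /\
    pt_set z n = true /\ pt_set z m = true /\
    forall k, (k >= k0)%nat -> / (INR j + 1) <= Rabs (g n k (pt_x z) - g m k (pt_x z)).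

Lemma oscillation_Fsigmadelta {X : Type} (d : X -> X -> R) (g : nat -> nat -> X -> R)
    (j : nat) :
  (forall n k, continuous_d d (g n k)) -> Fsigmadelta d (oscillation g j).
Proof.
  intros Hg. apply Fsigmadelta_forall. intros N. apply Fsigmadelta_Fsigma.
  apply Fsigma_exists. intros n. apply Fsigma_exists. intros m.
  apply Fsigma_exists. intros k0. apply Fsigma_closed.
  apply closed_and; [intros z Hz; destruct (Hz 0%nat) as [_ [_ H]]; exact H|].
  apply closed_and; [apply (closed_coord d n (fun b _ => b = true))|].
  apply closed_and; [apply (closed_coord d m (fun b _ => b = true))|].
  apply closed_eventually_ge; auto.
Qed.

(* The functions [fs (pt_seq z m)] accumulate at a function which agrees on [D] with every
   accumulation point of [fs] along [pt_set z], but differs from all of them at [pt_x z]. *)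
Definition twin_witness {X : Type} (D : X -> Prop) (e : X -> nat) (fs : nat -> X -> R)
    (g : nat -> nat -> X -> R) (N0 j0 : nat) (z : point X) : Prop :=
  (forall N, exists n, (n >= N)%nat /\ pt_set z n = true) /\
  (forall i j, exists N, forall y, D y -> e y = i -> forall n, (n >= N)%nat ->
    forall m, (m >= N)%nat -> pt_set z n = true ->
    Rabs (fs n y - fs (pt_seq z m) y) <= / (INR j + 1)) /\
  (forall n m, exists i k0, pt_seq z m = i /\ ((n >= N0)%nat -> pt_set z n = true ->
    forall k, (k >= k0)%nat -> / (INR j0 + 1) <= Rabs (g n k (pt_x z) - g i k (pt_x z)))).

(** Naming the value [i] of [pt_seq z m] in the last clause makes [g i k] a fixed continuous
    function on each closed set. In the middle clause each choice of [y], [n] and [m] constrains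
    finitely many coordinates, so the condition is closed once [N] is fixed. *)
Lemma twin_witness_Fsigmadelta {X : Type} (d : X -> X -> R) (D : X -> Prop) (e : X -> nat)
    (fs : nat -> X -> R) (g : nat -> nat -> X -> R) (N0 j0 : nat) :
  (forall n k, continuous_d d (g n k)) -> Fsigmadelta d (twin_witness D e fs g N0 j0).
Proof.
  intros Hg. apply Fsigmadelta_and; [|apply Fsigmadelta_and].
  - apply Fsigmadelta_forall. intros N. apply Fsigmadelta_Fsigma, Fsigma_exists.
    intros n. apply Fsigma_closed.
    apply closed_and; [intros z Hz; destruct (Hz 0%nat) as [_ [_ H]]; exact H|].
    apply (closed_coord d n (fun b _ => b = true)).
  - apply Fsigmadelta_forall. intros i. apply Fsigmadelta_forall. intros j.
    apply Fsigmadelta_Fsigma, Fsigma_exists. intros N. apply Fsigma_closed.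
    apply closed_forall. intros y. apply closed_forall. intros _.
    apply closed_forall. intros _. apply closed_forall. intros n.
    apply closed_forall. intros _. apply closed_forall. intros m.
    apply closed_forall. intros _.
    apply (closed_coord_imp d n (fun b _ => b = true)).
    apply (closed_coord d m (fun _ v => Rabs (fs n y - fs v y) <= / (INR j + 1))).
  - apply Fsigmadelta_forall. intros n. apply Fsigmadelta_forall. intros m.
    apply Fsigmadelta_Fsigma, Fsigma_exists. intros i. apply Fsigma_exists. intros k0.
    apply Fsigma_closed.
    apply closed_and; [apply (closed_coord d m (fun _ v => v = i))|].
    apply closed_forall. intros _.
    apply (closed_coord_imp d n (fun b _ => b = true)).
    apply closed_eventually_ge; auto.
Qed.

(** The selected functions need only accumulate at some [h]. With [h] in the fibre and excluded as
    an accumulation point along the index set, degree two leaves room for just one. *)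
Lemma twin_witness_converges {X : Type} (K : (X -> R) -> Prop) (D : X -> Prop) (e : X -> nat)
    (fs : nat -> X -> R) (g : nat -> nat -> X -> R) (N0 j0 : nat) (z : point X) :
  pw_compact K -> (forall n, K (fs n)) ->
  (forall n x, Un_cv (fun k => g n k x) (fs n x)) ->
  (forall f g h, K f -> K g -> K h -> agree D f g -> agree D g h ->
     f = g \/ g = h \/ f = h) ->
  twin_witness D e fs g N0 j0 z -> subseq_converges fs (pt_set z).
Proof.
  intros HK Hfs Hg Htwo [Hinf [HD Hx]].
  destruct (compact_cluster K (fun m => fs (pt_seq z m)) HK) as [h [Hh Hch]]; [auto|].
  assert (Hagree : forall f, cluster_along fs (pt_set z) f -> agree D f h).
  { intros f Hf y Hy. apply cond_eq. intros eps He.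
    destruct (RinvN_small (eps / 3)) as [j Hj]; [lra|].
    destruct (HD (e y) j) as [N HN].
    destruct (Hf (y :: nil) (eps / 3) ltac:(lra) N) as [n [Hn [HLn Hny]]].
    destruct (Hch (y :: nil) (eps / 3) ltac:(lra) N) as [m [Hm Hmy]].
    specialize (HN y Hy eq_refl n Hn m Hm HLn).
    specialize (Hny y (or_introl eq_refl)). specialize (Hmy y (or_introl eq_refl)).
    revert HN Hny Hmy. unfold Rabs. repeat destruct Rcase_abs; lra. }
  assert (Hdiff : forall f, cluster_along fs (pt_set z) f -> f <> h).
  { intros f Hf ->. pose proof (RinvN_pos j0) as Hpos.
    set (eps := / (INR j0 + 1)) in *.
    destruct (Hf (pt_x z :: nil) (eps / 2) ltac:(lra) N0) as [n [Hn [HLn Hnx]]].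
    destruct (Hch (pt_x z :: nil) (eps / 2) ltac:(lra) 0%nat) as [m [_ Hmx]].
    specialize (Hnx _ (or_introl eq_refl)). specialize (Hmx _ (or_introl eq_refl)).
    destruct (Hx n m) as [i [k0 [Hi Hge]]]. rewrite Hi in Hmx.
    assert (H : eps <= Rabs (fs n (pt_x z) - fs i (pt_x z))).
    { apply (Un_cv_dist_ge (fun k => g n k (pt_x z)) (fun k => g i k (pt_x z))); auto.
      exists k0. auto. }
    revert H Hnx Hmx. unfold Rabs. repeat destruct Rcase_abs; lra. }
  apply (unique_cluster_converges K); auto.
  intros f f' Hf Hf' Hc Hc'.
  destruct (Htwo f f' h) as [H|[H|H]]; auto.
  - intros y Hy. rewrite (Hagree f Hc y Hy), (Hagree f' Hc' y Hy). reflexivity.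
  - destruct (Hdiff f' Hc' H).
  - destruct (Hdiff f Hc H).
Qed.

(** Density speaks of finite lists of points; this supplies the lists that exhaust [D]. *)
Lemma countable_initial_segment {X : Type} (D : X -> Prop) (e : X -> nat) :
  (forall a b, D a -> D b -> e a = e b -> a = b) ->
  forall m, exists l : list X, forall y, D y -> (e y <= m)%nat -> In y l.
Proof.
  intros He m.
  assert (Hone : forall i, exists l : list X, forall y, D y -> e y = i -> In y l).
  { intros i. destruct (classic (exists y, D y /\ e y = i)) as [[y [Hy Hi]]|Hno].
    - exists (y :: nil). intros y' Hy' Hi'. left. apply He; congruence.
    - exists nil. intros y Hy Hi. apply Hno. eauto. }
  induction m as [|m [l Hl]].
  - destruct (Hone 0%nat) as [l Hl]. exists l. intros y Hy Hm. apply Hl; auto. lia.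
  - destruct (Hone (S m)) as [l' Hl']. exists (l ++ l'). intros y Hy Hm.
    apply in_or_app. destruct (Nat.eq_dec (e y) (S m)); [right|left]; auto.
    apply Hl; auto. lia.
Qed.

(** Density gives [s m] whose function approximates the twin [h] at [x] and at the points of [D]
    with code at most [m], within an error that tends to 0 and never exceeds [/ (INR j0 + 1)]. *)
Lemma converges_twin_witness {X : Type} (K : (X -> R) -> Prop) (D : X -> Prop) (e : X -> nat)
    (fs : nat -> X -> R) (g : nat -> nat -> X -> R) (L : nat -> bool) (f h : X -> R) :
  (forall a b, D a -> D b -> e a = e b -> a = b) ->
  dense_seq fs K ->
  (forall n x, Un_cv (fun k => g n k x) (fs n x)) ->
  infinite_set L ->
  (forall x eps, eps > 0 -> exists N, forall n, (n >= N)%nat -> L n = true ->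
     Rabs (fs n x - f x) < eps) ->
  K h -> h <> f -> agree D f h ->
  exists N0 j0, image pt_set (twin_witness D e fs g N0 j0) L.
Proof.
  intros He [_ Hdense] Hg Hinf Hcv Hh Hne Hag.
  assert (exists x, h x <> f x) as [x Hx].
  { apply NNPP. intros Hno. apply Hne, functional_extensionality. intros x.
    apply NNPP. intros H. apply Hno. exists x. exact H. }
  assert (Hpos : Rabs (f x - h x) > 0) by (apply Rabs_pos_lt; lra).
  (* One third of the gap is spent on the distance to [f], one on the distance to [h]; the third
     that remains exceeds [/ (INR j0 + 1)]. *)
  destruct (RinvN_small (Rabs (f x - h x) / 3)) as [j0 Hj0]; [lra|].
  destruct (Hcv x (Rabs (f x - h x) / 3)) as [N0 HN0]; [lra|].
  assert (exists s : nat -> nat, forall m,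
      Rabs (fs (s m) x - h x) < / (INR (j0 + m) + 1) /\
      forall y, D y -> (e y <= m)%nat -> Rabs (fs (s m) y - h y) < / (INR (j0 + m) + 1))
    as [s Hs].
  { apply (choice_fun (fun m n => Rabs (fs n x - h x) < / (INR (j0 + m) + 1) /\
      forall y, D y -> (e y <= m)%nat -> Rabs (fs n y - h y) < / (INR (j0 + m) + 1))).
    intros m. destruct (countable_initial_segment D e He m) as [l Hl].
    destruct (Hdense h Hh (x :: l) (/ (INR (j0 + m) + 1)) (RinvN_pos _))
      as [u [[n ->] Hn]].
    exists n. split; [apply Hn; left; reflexivity|].
    intros y Hy Hm. apply Hn. right. auto. }
  exists N0, j0, (Point x L s). split; [|reflexivity]. split; [exact Hinf|split].
  - intros i j. simpl.
    destruct (classic (exists y, D y /\ e y = i)) as [[y [Hy Hi]]|Hno].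
    + pose proof (RinvN_pos j) as Hjpos.
      destruct (Hcv y (/ (INR j + 1) / 2)) as [N1 HN1]; [lra|].
      destruct (RinvN_small (/ (INR j + 1) / 2)) as [N2 HN2]; [lra|].
      (* [N1] serves convergence at [y], [N2] the accuracy of [s], and [i] puts [y], whose code is
         [i], among the points controlled at stage [m]. *)
      exists (N1 + N2 + i)%nat. intros y' Hy' Hi' n Hn m Hm HLn.
      assert (y' = y) as -> by (apply He; congruence).
      specialize (HN1 n ltac:(lia) HLn).
      destruct (Hs m) as [_ Hsm]. specialize (Hsm y Hy ltac:(lia)).
      pose proof (RinvN_anti N2 (j0 + m) ltac:(lia)).
      rewrite (Hag y Hy) in HN1.
      revert HN1 Hsm. unfold Rabs. repeat destruct Rcase_abs; lra.
    + exists 0%nat. intros y Hy Hi. destruct Hno. eauto.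
  - intros n m. simpl. exists (s m).
    destruct (classic ((n >= N0)%nat /\ L n = true)) as [[Hn HLn]|Hno].
    + destruct (Un_cv_dist_gt (fun k => g n k x) (fun k => g (s m) k x)
        (fs n x) (fs (s m) x) (/ (INR j0 + 1))) as [k0 Hk0]; auto.
      * specialize (HN0 n Hn HLn). destruct (Hs m) as [Hsm _].
        pose proof (RinvN_anti j0 (j0 + m) ltac:(lia)).
        revert HN0 Hsm Hj0. unfold Rabs. repeat destruct Rcase_abs; lra.
      * exists k0. auto.
    + exists 0%nat. tauto.
Qed.

(** * Functions alone in their fibre over [D] *)

(** Splitting by the code [i] turns the quantifier over [D] into a countable intersection; what is
    left inside depends on single coordinates [L n]. *)
Lemma borel_converges_on {X : Type} (D : X -> Prop) (e : X -> nat) (fs : nat -> X -> R)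
    (f : X -> R) :
  cantor_borel (fun L => forall i j, exists N, forall n, L n = true -> (n >= N)%nat ->
    forall y, D y -> e y = i -> Rabs (fs n y - f y) < / (INR j + 1)).
Proof.
  apply borel_inter. intros i. apply borel_inter. intros j.
  apply (borel_union (fun N L => forall n, L n = true -> (n >= N)%nat ->
    forall y, D y -> e y = i -> Rabs (fs n y - f y) < / (INR j + 1))).
  intros N. apply borel_inter. intros n.
  apply (borel_coord n (fun b => b = true -> (n >= N)%nat ->
    forall y, D y -> e y = i -> Rabs (fs n y - f y) < / (INR j + 1))).
Qed.

(** The separator is convergence to [f] on [D]: it makes every accumulation point agree with [f] on
    [D], hence equal [f], and this forces convergence everywhere. *)
Lemma singleton_fibre_separated {X : Type} (K : (X -> R) -> Prop) (D : X -> Prop)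
    (fs : nat -> X -> R) (f : X -> R) :
  countable D -> pw_compact K -> (forall n, K (fs n)) ->
  (forall g, K g -> agree D f g -> g = f) ->
  borel_separated (fun L => cluster_along fs L f /\ subseq_converges fs L)
    (fun L => infinite_set L /\ ~ subseq_converges fs L).
Proof.
  intros [e He] HK Hfs Hf.
  eexists. split; [exact (borel_converges_on D e fs f)|split].
  - intros L [Hc Hcv] i j.
    destruct (classic (exists y, D y /\ e y = i)) as [[y [Hy Hi]]|Hno].
    + destruct (cluster_is_limit fs L f Hcv Hc y _ (RinvN_pos j)) as [N HN].
      exists N. intros n HLn Hn y' Hy' Hi'.
      assert (y' = y) as -> by (apply He; congruence). auto.
    + exists 0%nat. intros n _ _ y Hy Hi. destruct Hno. eauto.
  - intros L [Hinf Hno] HL. apply Hno.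
    apply (unique_cluster_converges K); auto.
    assert (H : forall h, K h -> cluster_along fs L h -> h = f).
    { intros h Hh Hc. apply Hf; [exact Hh|]. intros y Hy. apply cond_eq. intros eps Heps.
      destruct (RinvN_small (eps / 2)) as [j Hj]; [lra|].
      destruct (HL (e y) j) as [N HN].
      destruct (Hc (y :: nil) (eps / 2) ltac:(lra) N) as [n [Hn [HLn Hny]]].
      specialize (Hny y (or_introl eq_refl)).
      specialize (HN n HLn Hn y Hy eq_refl).
      revert HN Hny. unfold Rabs. repeat destruct Rcase_abs; lra. }
    intros h h' Hh Hh' Hc Hc'. rewrite (H h), (H h'); auto.
Qed.

(** * Assembling the countably many separations *)

Theorem theorem5p2 (X : Type) (d : X -> X -> R) (K : (X -> R) -> Prop)
  (HX : polish_metric d)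
  (HK : rosenthal_compact d K)
  (Hsep : separable_pw K)
  (Hdeg : premetric_degree_two K) :
  forall fs : nat -> X -> R, dense_seq fs K -> borel_in_infsets (L_set fs).
Proof.
  intros fs Hdense. destruct HK as [Hbaire HK].
  destruct Hdeg as [D [DD [HDc [[eDD HDDc] [HDD [Htwo Hpair]]]]]].
  assert (Hfs : forall n, K (fs n)) by (intros n; apply Hdense; exists n; reflexivity).
  destruct (choice_fun _ (fun n => Hbaire _ (Hfs n))) as [g Hg].
  assert (Hgc : forall n k, continuous_d d (g n k)) by (intros n; apply Hg).
  assert (Hgl : forall n x, Un_cv (fun k => g n k x) (fs n x)) by (intros n; apply Hg).
  pose proof HDc as [eD HeD].
  (* The number [c] codes the pair [(N0, j0)], and [m] below codes a function of [DD], so both cases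
     become countable unions. *)
  set (T := fun c => twin_witness D eD fs g (fst (of_nat c)) (snd (of_nat c))).
  set (F := fun m L => exists f, DD f /\ eDD f = m /\
    (forall g, K g -> agree D f g -> g = f) /\ cluster_along fs L f /\ subseq_converges fs L).
  assert (Hmain : borel_separated (L_set fs)
      (fun L => infinite_set L /\ ~ subseq_converges fs L)).
  { apply separated_mono with
      (A' := fun L => (exists c, image pt_set (T c) L) \/ (exists m, F m L))
      (B' := fun L => infinite_set L /\ ~ subseq_converges fs L); [|auto|].
    - intros L [Hinf Hcv].
      destruct (cluster_along_exists K fs L HK Hfs Hinf) as [f [Hf Hc]].
      destruct (classic (exists h, K h /\ h <> f /\ agree D f h)) as [[h [Hh [Hne Hag]]]|Hno].
      + left. destruct (converges_twin_witness K D eD fs g L f h) as [N0 [j0 Hw]]; auto.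
        { apply cluster_is_limit; assumption. }
        exists (to_nat (N0, j0)). unfold T. rewrite cancel_of_to. exact Hw.
      + right. exists (eDD f), f. split; [|split; [reflexivity|split; [|auto]]].
        (* A function outside [DD] has a twin, so a limit without one lies in [DD]. *)
        * apply NNPP. intros HnD. destruct (Hpair f Hf HnD) as [h [Hh [Hne Hag]]].
          apply Hno. exists h. split; [exact Hh|split; [exact Hne|]].
          intros x Hx. symmetry. auto.
        * intros h Hh Hag. apply NNPP. intros Hne. apply Hno. eauto.
    - apply separated_or.
      + apply separated_mono with (A' := fun L => exists c, image pt_set (T c) L)
          (B' := fun L => exists j, image pt_set (oscillation g j) L); [auto| |].
        * intros L [Hinf Hno].
          destruct (not_converges_oscillates fs L Hinf Hno) as [x [j Hosc]].
          exists j, (Point x L (fun _ => O)). split; [|reflexivity].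
          intros N. destruct (Hosc N) as [n [m [Hn [Hm [HLn [HLm Hgt]]]]]].
          destruct (Un_cv_dist_gt _ _ _ _ _ (Hgl n x) (Hgl m x) Hgt) as [k0 Hk0].
          exists n, m, k0. auto.
        * apply separated_union. intros c j. apply (Fsigmadelta_separation d); auto.
          { apply twin_witness_Fsigmadelta, Hgc. }
          { apply oscillation_Fsigmadelta, Hgc. }
          (* A common index set would give convergence because of [z] and divergence because of
             [w]. *)
          intros z w Hz Hw Heq.
          apply (oscillates_not_converges fs (pt_set w) (pt_x w) (/ (INR j + 1)));
            [apply RinvN_pos| |].
          { intros N. destruct (Hw N) as [n [m [k0 [[Hn Hm] [HLn [HLm Hge]]]]]].
            exists n, m. repeat split; auto.
            apply (Un_cv_dist_ge (fun k => g n k (pt_x w)) (fun k => g m k (pt_x w))); auto.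
            exists k0. exact Hge. }
          rewrite <- Heq. apply (twin_witness_converges K D eD fs g _ _ z HK Hfs Hgl Htwo Hz).
      + apply separated_mono with (A' := fun L => exists m, F m L)
          (B' := fun L => exists l : nat, infinite_set L /\ ~ subseq_converges fs L);
          [auto|intros L H; exists O; exact H|].
        apply (separated_union F (fun _ L => infinite_set L /\ ~ subseq_converges fs L)).
        intros m _.
        (* Injectivity of [eDD] on [DD] leaves at most one function for [m]; if there is none, [F m]
           is empty. *)
        destruct (classic (exists f, DD f /\ eDD f = m /\
          forall g, K g -> agree D f g -> g = f)) as [[f [Hf [Hm Hsingle]]]|Hno].
        * eapply separated_mono; [| |exact (singleton_fibre_separated K D fs f HDc HK Hfs Hsingle)];
            [|auto].
          intros L [f' [Hf' [Hm' [_ Hc]]]].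
          assert (f' = f) as -> by (apply HDDc; congruence). exact Hc.
        * apply separated_empty_l. intros L [f [Hf [Hm [Hsingle _]]]]. apply Hno. eauto. }
  (* Among infinite sets the two separated families are complementary, so there the separator
     coincides with [L_set fs]. *)
  destruct Hmain as [B [HB [H1 H2]]].
  split; [intros A HA; apply HA|]. exists B. split; [exact HB|].
  intros A HA. split; [apply H1|]. intros HBA. split; [exact HA|].
  apply NNPP. intros Hno. exact (H2 A (conj HA Hno) HBA).
Qed.
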